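(* Let $A\geq a\geq 1$ be integers, and let $Omes_{1,A,a}$ be the set of overpartitions $\pi$ such that all parts of $\pi$ of size $\equiv a\pmod A$ and less than $mes_{1,A,a}(\pi)$ are overlined. Then \[ \sum_{\pi\in Omes_{1,A,a}}z^{mes_{1,A,a}(\pi)}q^{|\pi|} =\frac{(-q;q)_{\infty}}{(q;q)_{\infty}}\sum_{k=0}^{\infty}z^{kA+a}\bigg[q^{A\binom{k}{2}+ka} \frac{(q^a;q^A)_k}{(-q^a;q^A)_k}-2q^{A\binom{k+1}{2}+(k+1)a} \frac{(q^a;q^A)_k}{(-q^a;q^A)_{k+1}}\bigg]. \]
   Context: An overpartition is a partition (finite non-increasing sequence of positive integers) in which the first occurrence of each part value may be overlined; $|\pi|$ is the sum of parts. A part is of size $t$ if it equals $t$ or $\overline{t}$. $(a;q)_\infty=\prod_{i\geq0}(1-aq^i)$, $(a;q)_n=(a;q)_\infty/(aq^n;q)_\infty$; $|q|<1$, $z$ a formal variable. $mes_{1,A,a}(\pi)$ is the smallest positive integer $\equiv a\pmod A$ such that no part of $\pi$ has that size. *)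

(* Defs.v *)
From HB Require Import structures.
From mathcomp Require Import all_boot all_order all_algebra.
From mathcomp Require Import finmap complex zify.
From mathcomp Require Import all_classical all_reals all_analysis summability.

Set Implicit Arguments.
Unset Strict Implicit.
Unset Printing Implicit Defensive.

Import Order.TTheory GRing.Theory Num.Theory.
Import numFieldNormedType.Exports.

Local Open Scope classical_set_scope.

(* A part is a pair (t, b): it has size t and is overlined iff b = true. *)
Definition part : Type := (nat * bool)%type.
Definition psize (p : part) : nat := p.1.
Definition overlined (p : part) : bool := p.2.

Definition is_overpartition (s : seq part) : bool :=
  [&& all (fun p => 0 < psize p) s,
      sorted geq (map psize s)
    & [forall i : 'I_(size s),
         overlined (nth (0, false) s i) ==>
         (psize (nth (0, false) s i) \notin map psize (take i s))]].

Record overpartition : Type := Overpartition {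
  parts :> seq part;
  partsP : is_overpartition parts }.

HB.instance Definition _ := [isSub for parts].
HB.instance Definition _ := [Countable of overpartition by <:].

Definition weight (pi : overpartition) : nat := sumn (map psize pi).

Definition missing (A a : nat) (pi : overpartition) (m : nat) : Prop :=
  [/\ 0 < m, m = a %[mod A] & forall p, p \in parts pi -> psize p <> m].

(* The default value 0 is only taken when no candidate exists, which does not
   happen for 0 < A (lemma mesP). *)
Definition mes (A a : nat) (pi : overpartition) : nat :=
  xget 0 [set m | missing A a pi m /\ forall m', missing A a pi m' -> m <= m'].

Lemma mesP (A a : nat) (pi : overpartition) : 0 < A ->
  missing A a pi (mes A a pi) /\
  forall m, missing A a pi m -> mes A a pi <= m.
Proof.
move=> A0; rewrite /mes; case: xgetP => [m _ []//|noP]; exfalso.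
have ex : exists m, `[< missing A a pi m >].
  exists (a + (weight pi).+1 * A); apply/asboolP; split.
  - by rewrite addn_gt0 muln_gt0 A0 orbT.
  - by rewrite addnC modnMDl.
  - move=> p ppi; suff : psize p <= weight pi by nia.
    rewrite /weight; elim: (parts pi) ppi => //= x s IH.
    rewrite inE => /orP[/eqP->|/IH]; first exact: leq_addr.
    by move/leq_trans; apply; exact: leq_addl.
have [m /asboolP Pm mmin] := ex_minnP ex.
by apply: (noP m); split=> // m' Pm'; apply: mmin; apply/asboolP.
Qed.

(* An overlined part is a first occurrence, so a part size that satisfies the
   condition below occurs exactly once. *)
Definition Omes (A a : nat) : set overpartition :=
  [set pi | forall p, p \in parts pi ->
      psize p = a %[mod A] -> psize p < mes A a pi -> overlined p].

Local Open Scope ring_scope.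

Definition qpoch_inf (K : numFieldType) (x q : K) : K :=
  lim ((\prod_(0 <= i < n) (1 - x * q ^+ i)) @[n --> \oo]).

Definition qpoch (K : numFieldType) (x q : K) (n : nat) : K :=
  qpoch_inf x q / qpoch_inf (x * q ^+ n) q.

(* Formal power series in z over K, given by their coefficients and with
   coefficientwise convergence. *)
Definition fps (K : Type) : Type := nat -> K.

(* c z^m *)
Definition fps_monom (K : numFieldType) (c : K) (m : nat) : fps K :=
  fun n => if n == m then c else 0.

Definition fps_scale (K : numFieldType) (c : K) (f : fps K) : fps K :=
  fun n => c * f n.

Definition fps_series (K : numFieldType) (u : nat -> fps K) : fps K :=
  fun n => lim ((\sum_(0 <= k < N) u k n) @[N --> \oo]).

(* \sum_(i in D) f i = g, the sum being unordered (totally is the filter of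
   finite subsets of I ordered by inclusion) *)
Definition fps_has_sum (K : numFieldType) (I : choiceType) (D : set I)
    (f : I -> fps K) (g : fps K) : Prop :=
  forall n, (\sum_(i <- F | i \in D) f i n) @[F --> totally] --> g n.

(* Main.v *)
Require Import Defs.
From mathcomp Require Import all_boot all_order all_algebra.
From mathcomp Require Import finmap complex zify ring lra.
From mathcomp Require Import all_classical all_reals all_analysis summability.
Set Implicit Arguments.
Unset Strict Implicit.
Unset Printing Implicit Defensive.
Import Order.TTheory GRing.Theory Num.Theory.
Import numFieldNormedType.Exports.
Local Open Scope classical_set_scope.

(* An overpartition is determined by the numbers of plain and overlined parts of
   each size, and prescribing these numbers for finitely many sizes multiplies the
   generating function (-q;q)_oo / (q;q)_oo by one explicit factor per size.  An
   overpartition lies in Omes with mes = kA+a iff each of the sizes jA+a with j < k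
   occurs exactly once, overlined, and the size kA+a does not occur.  The coefficient
   of z^(kA+a) is therefore (-q;q)_oo / (q;q)_oo times
     \prod_(j < k) q^(jA+a) * \prod_(j <= k) (1 - q^(jA+a)) / (1 + q^(jA+a)),
   to which the bracket of the theorem reduces.

   To make this an unordered sum, exhaust the overpartitions by those with part sizes
   and plain multiplicities at most N: the generating function of the latter is a
   finite product, which converges both at q and at |q|, whence absolute
   summability. *)

(** * Overpartitions and multiplicities *)

(* Not reflexive at overlined parts: pairwise, it forces an overlined part to be
   the first of its size. *)
Definition part_precedes : rel part :=
  [rel p p' | (psize p' <= psize p) && ((psize p == psize p') ==> ~~ overlined p')].

Lemma part_precedes_trans : transitive part_precedes.
Proof. by move=> [t b] [u c] [v d]; rewrite /part_precedes/psize/overlined/=; lia. Qed.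

Lemma part_precedes_anti : antisymmetric part_precedes.
Proof.
move=> [t b] [u c]; rewrite /part_precedes/psize/overlined/= => precedes.
have size_eq : t = u by lia.
by move: precedes; rewrite size_eq leqnn eqxx; case: b c => [] [].
Qed.

Lemma overlined_first_pairwise (s : seq part) :
  [forall i : 'I_(size s), overlined (nth (0, false) s i) ==>
     (psize (nth (0, false) s i) \notin map psize (take i s))] =
  pairwise [rel p p' | (psize p == psize p') ==> ~~ overlined p'] s.
Proof.
apply/forallP/(pairwiseP (0, false)) => [first i j _ lt_js lt_ij | later [i lt_is]].
  apply/implyP => /eqP psize_ij; apply/negP.
  move=> /(implyP (first (Ordinal lt_js))) /mapP; apply.
  exists (nth (0, false) s i) => //=.
  by rewrite -(nth_take (0, false) lt_ij) mem_nth// size_takel// ltnW.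
apply/implyP => ov_i; apply/negP => /mapP[p /(nthP (0, false))[j]].
rewrite size_take lt_is => lt_ji; rewrite nth_take// => <- psize_ij.
by have := later j i (ltn_trans lt_ji lt_is) lt_is lt_ji; rewrite /= psize_ij eqxx ov_i.
Qed.

Lemma is_overpartitionE (s : seq part) :
  is_overpartition s = all (fun p => 0 < psize p) s && pairwise part_precedes s.
Proof.
rewrite /is_overpartition overlined_first_pairwise pairwise_relI.
by rewrite (sorted_pairwise (rev_trans leq_trans)) pairwise_map.
Qed.

Lemma overpartition_perm_inj (pi rho : overpartition) :
  perm_eq (parts pi) (parts rho) -> pi = rho.
Proof.
have parts_sorted (sigma : overpartition) : sorted part_precedes (parts sigma).
  have := partsP sigma; rewrite is_overpartitionE => /andP[_].
  by rewrite (sorted_pairwise part_precedes_trans).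
by move=> perm_pi; apply/val_inj/(sorted_eq part_precedes_trans part_precedes_anti).
Qed.

Lemma psize_gt0 (pi : overpartition) p : p \in parts pi -> 0 < psize p.
Proof. by have /and3P[/allP + _ _] := partsP pi; apply. Qed.

Lemma psize_le_weight (pi : overpartition) p : p \in parts pi -> psize p <= weight pi.
Proof. by move=> p_pi; rewrite /weight sumnE big_map (big_rem p)//= leq_addr. Qed.

Lemma count_mem_overlined (pi : overpartition) t :
  count_mem (t, true) (parts pi) = ((t, true) \in parts pi).
Proof.
have := partsP pi; rewrite is_overpartitionE => /andP[_].
elim: (parts pi) => //= p s IHs /andP[/allP p_precedes /IHs ->].
rewrite in_cons [_ == p]eq_sym; case: eqVneq => //= p_t.
case: (boolP (_ \in s)) => // /p_precedes.
by rewrite p_t /part_precedes/psize/= leqnn eqxx.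
Qed.

Definition mult (pi : overpartition) (t : nat) : nat * bool :=
  (count_mem (t, false) (parts pi), (t, true) \in parts pi).

Lemma mult_le_weight (pi : overpartition) t : (mult pi t).1 <= weight pi.
Proof.
rewrite /weight sumnE big_map /mult/= -sum1_count big_mkcond/= big_seq [leqRHS]big_seq.
by apply: leq_sum => p /psize_gt0; case: ifP.
Qed.

Lemma mult_eq0P (pi : overpartition) t :
  reflect (forall p, p \in parts pi -> psize p <> t) (mult pi t == (0, false)).
Proof.
rewrite /mult xpair_eqE -leqn0 leqNgt -has_count has_pred1 eqbF_neg.
apply: (iffP andP) => [[no_plain no_overlined] [u b] /= + u_t | missing_t].
  by rewrite u_t; case: b; apply/negP.
by split; apply/negP => /missing_t.
Qed.

Fixpoint parts_of_mult (m : nat -> nat * bool) (N : nat) : seq part :=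
  if N is n.+1 then
    nseq (m N).2 (N, true) ++ nseq (m N).1 (N, false) ++ parts_of_mult m n
  else [::].

Lemma psize_parts_of_mult m N p : p \in parts_of_mult m N -> 0 < psize p <= N.
Proof.
elim: N => //= n IHn; rewrite !mem_cat !mem_nseq.
move=> /or3P[/andP[_ /eqP->] | /andP[_ /eqP->] | /IHn /andP[-> /leqW->]] //.
all: by rewrite /psize/= leqnn.
Qed.

Lemma count_parts_of_mult m N t b :
  count_mem (t, b) (parts_of_mult m N) =
  if 0 < t <= N then (if b then nat_of_bool (m t).2 else (m t).1) else 0.
Proof.
elim: N => [|n IHn] /=; first by case: t.
rewrite !count_cat IHn !count_nseq /= !xpair_eqE [n.+1 == t]eq_sym.
rewrite [t <= n.+1]leq_eqVlt ltnS.
by case: eqVneq => [->|//]; rewrite ltnn andbF; case: b {IHn}; rewrite /= ?mul1n ?addn0.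
Qed.

Lemma parts_of_multP m N : is_overpartition (parts_of_mult m N).
Proof.
rewrite is_overpartitionE; apply/andP; split.
  by apply/allP => p /psize_parts_of_mult /andP[].
elim: N => //= n IHn; rewrite !pairwise_cat IHn andbT.
have plain_last b k l : allrel part_precedes (nseq k (n.+1, b)) (nseq l (n.+1, false)).
  apply/allrelP => p p'; rewrite !mem_nseq => /andP[_ /eqP->] /andP[_ /eqP->].
  by rewrite /part_precedes/= leqnn implybT.
have larger_first b k : allrel part_precedes (nseq k (n.+1, b)) (parts_of_mult m n).
  apply/allrelP => p p'; rewrite mem_nseq => /andP[_ /eqP->] /psize_parts_of_mult.
  by rewrite /part_precedes/psize/=; lia.
rewrite allrel_catr plain_last !larger_first /=; apply/andP; split.
  by case: (m _).2.
elim: (m _).1 => //= k ->; rewrite andbT.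
by rewrite -allrel1l; exact: (plain_last false 1 k).
Qed.

Definition of_mult (m : nat -> nat * bool) (N : nat) : overpartition :=
  Overpartition (parts_of_multP m N).

Lemma mult_of_mult m N t :
  mult (of_mult m N) t = if 0 < t <= N then m t else (0, false).
Proof.
rewrite /mult -has_pred1 has_count /= !count_parts_of_mult.
by case: ifP => // _; case: (m t) => n [].
Qed.

Lemma of_multK (pi : overpartition) N :
  (forall p, p \in parts pi -> psize p <= N) -> of_mult (mult pi) N = pi.
Proof.
move=> le_pi_N; apply: overpartition_perm_inj; apply/allP => -[t b] _ /=; apply/eqP.
rewrite count_parts_of_mult; case: ifP => [_|t_out].
  by case: b; rewrite //= count_mem_overlined.
apply/esym/count_memPn; apply: contraFN t_out => t_pi.
by rewrite (psize_gt0 t_pi) (le_pi_N _ t_pi).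
Qed.

Lemma eq_of_mult m m' N : (forall t, 0 < t <= N -> m t = m' t) ->
  of_mult m N = of_mult m' N.
Proof.
move=> eq_m; apply: overpartition_perm_inj; apply/allP => -[t b] _ /=; apply/eqP.
by rewrite !count_parts_of_mult; case: ifP => // /eq_m ->.
Qed.

Lemma weight_of_mult m N :
  weight (of_mult m N) = \sum_(i < N) i.+1 * ((m i.+1).1 + (m i.+1).2).
Proof.
rewrite /weight /=; elim: N => [|n IHn]; first by rewrite big_ord0.
by rewrite big_ord_recr /= !map_cat !sumn_cat !map_nseq IHn !sumn_nseq /psize /=; lia.
Qed.

Definition with_mult (Q : nat -> pred (nat * bool)) : set overpartition :=
  [set pi | forall t, 0 < t -> Q t (mult pi t)].

(* f i is the multiplicity of the size i.+1; the value at t = 0 is junk. *)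
Definition mult_of_ffun N (f : {ffun 'I_N -> 'I_N.+1 * bool}) (t : nat) : nat * bool :=
  if insub t.-1 is Some i then (val (f i).1, (f i).2) else (0, false).

Lemma mult_of_ffunE N f (i : 'I_N) : mult_of_ffun f i.+1 = (val (f i).1, (f i).2).
Proof. by rewrite /mult_of_ffun /= valK. Qed.

Section BoundedOverpartitions.
Variables (Q : nat -> pred (nat * bool)) (N : nat).

Definition bounded_mult (i : 'I_N) : pred ('I_N.+1 * bool) :=
  [pred j | Q i.+1 (val j.1, j.2)].

Definition bounded_overpartitions : seq overpartition :=
  [seq of_mult (mult_of_ffun f) N | f in family bounded_mult].

Lemma bounded_overpartitions_uniq : uniq bounded_overpartitions.
Proof.
rewrite map_inj_uniq ?enum_uniq// => f g eq_fg; apply/ffunP => i.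
have := congr1 (fun pi => mult pi i.+1) eq_fg.
rewrite !mult_of_mult ltn_ord /= !mult_of_ffunE.
by case: (f i) (g i) => [x b] [y c] [/val_inj -> ->].
Qed.

Lemma mem_bounded_overpartitions (pi : overpartition) :
  weight pi <= N -> with_mult Q pi -> pi \in bounded_overpartitions.
Proof.
move=> le_pi_N Q_pi.
pose f : {ffun 'I_N -> 'I_N.+1 * bool} :=
  [ffun i : 'I_N => (inord (mult pi i.+1).1, (mult pi i.+1).2)].
have fE (i : 'I_N) : (val (f i).1, (f i).2) = mult pi i.+1.
  by rewrite ffunE /= inordK// ltnS (leq_trans (mult_le_weight _ _)).
apply/fintype.imageP; exists f.
  by apply/familyP => i; rewrite inE fE; exact: Q_pi.
rewrite -[LHS](@of_multK _ N); last by move=> p /psize_le_weight /leq_trans; apply.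
apply: eq_of_mult => -[//|t] /andP[_ lt_tN].
by rewrite (mult_of_ffunE f (Ordinal lt_tN)) fE.
Qed.

Lemma bounded_overpartitions_with_mult (pi : overpartition) :
  (forall t, N < t -> Q t (0, false)) ->
  pi \in bounded_overpartitions -> with_mult Q pi.
Proof.
move=> Q_large /fintype.imageP[f /familyP Q_f ->] t t_gt0.
rewrite mult_of_mult t_gt0 /=; case: leqP => [|/Q_large//].
case: t t_gt0 => // t _ lt_tN; have := Q_f (Ordinal lt_tN).
by rewrite inE (mult_of_ffunE f (Ordinal lt_tN)).
Qed.

Lemma sum_bounded_overpartitions (K : comNzRingType) (q : K) :
  (\sum_(pi <- bounded_overpartitions) q ^+ weight pi =
   \prod_(i < N) \sum_(j | bounded_mult i j) q ^+ (i.+1 * (j.1 + j.2)))%R.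
Proof.
rewrite bigA_distr_big_dep big_map big_enum; apply: eq_bigr => f _ /=.
rewrite weight_of_mult -prodrXr; apply: eq_bigr => i _.
by rewrite mult_of_ffunE.
Qed.

End BoundedOverpartitions.

(** * The smallest missing size of a residue class *)

Definition prescribed (S : seq nat) (m : nat -> nat * bool) (t : nat) :
    pred (nat * bool) :=
  [pred j | (t \in S) ==> (j == m t)].

Definition progression (A a k : nat) : seq nat := mkseq (fun j => j * A + a) k.

Lemma progression_uniq (A a k : nat) : 0 < A -> uniq (progression A a k).
Proof. by move=> A_gt0; apply: mkseq_uniq => i j; nia. Qed.

Lemma progression_gt0 (A a k t : nat) : 0 < a -> t \in progression A a k -> 0 < t.
Proof. by move=> a_gt0 /mapP[j _ ->]; lia. Qed.

Lemma modn_eq_progression (A a t : nat) : 0 < a <= A -> 0 < t ->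
  t = a %[mod A] -> exists k, t = k * A + a.
Proof.
move=> /andP[a_gt0 le_aA] t_gt0 t_a; have le_at : a <= t.
  rewrite leqNgt; apply/negP => lt_ta; move: t_a; rewrite modn_small; last by lia.
  by have [->|a_neq_A] := eqVneq a A; rewrite ?modnn ?modn_small; lia.
exists ((t - a) %/ A); move/eqP: t_a; rewrite eqn_mod_dvd// => /divnK ->.
by rewrite subnK.
Qed.

Lemma mem_progression (A a k t : nat) : 0 < a <= A -> 0 < t ->
  (t \in progression A a k.+1) = (t == a %[mod A]) && (t <= k * A + a).
Proof.
move=> aA t_gt0; apply/mapP/andP => [[j + ->] | [/eqP t_a le_t]].
  by rewrite modnMDl mem_iota; split=> //; nia.
have [j t_j] := modn_eq_progression aA t_gt0 t_a.
by exists j; rewrite // mem_iota; nia.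
Qed.

Lemma mes_progression (A a : nat) (pi : overpartition) : 0 < a <= A ->
  exists k, mes A a pi = k * A + a.
Proof.
move=> aA; have [|[mes_gt0 mes_a _] _] := @mesP A a pi; first by lia.
exact: modn_eq_progression.
Qed.

Lemma with_mult_progressionP (A a k : nat) (m : nat -> nat * bool)
    (pi : overpartition) : 0 < a <= A ->
  with_mult (prescribed (progression A a k.+1) m) pi <->
  (forall t, 0 < t -> t = a %[mod A] -> t <= k * A + a -> mult pi t = m t).
Proof.
move=> aA; split=> [pi_m t t_gt0 /eqP t_a le_t | pi_m t t_gt0].
  by apply/eqP/(implyP (pi_m t t_gt0)); rewrite mem_progression// t_a.
apply/implyP; rewrite mem_progression// => /andP[/eqP t_a le_t].
exact/eqP/pi_m.
Qed.

Lemma Omes_mult (A a t : nat) (pi : overpartition) : 0 < A -> Omes A a pi ->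
  0 < t -> t = a %[mod A] -> t <= mes A a pi -> mult pi t = (0, t < mes A a pi).
Proof.
move=> A_gt0 pi_Omes t_gt0 t_a; have [[_ _ mes_missing] mes_le] := mesP a pi A_gt0.
rewrite leq_eqVlt => /predU1P[->|lt_t_mes]; first by rewrite ltnn; exact/eqP/mult_eq0P.
have no_plain : (t, false) \notin parts pi by apply/negP => /pi_Omes /(_ t_a lt_t_mes).
have not_missing : mult pi t != (0, false).
  by apply: contraTN lt_t_mes => /mult_eq0P t_missing; rewrite -leqNgt mes_le.
move: not_missing; rewrite /mult lt_t_mes (count_memPn no_plain).
by case: (_ \in _).
Qed.

Lemma mes_eq_of_mult (A a k : nat) (pi : overpartition) : 0 < a <= A ->
  (forall t, 0 < t -> t = a %[mod A] -> t <= k * A + a ->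
     mult pi t = (0, t < k * A + a)) ->
  mes A a pi = k * A + a.
Proof.
move=> aA multE; have [|[mes_gt0 mes_a mes_missing] mes_le] := @mesP A a pi.
  by lia.
have missing_k : missing A a pi (k * A + a).
  split; [by lia | by rewrite modnMDl | apply/mult_eq0P].
  by rewrite multE ?ltnn ?modnMDl//; lia.
have le_mes_k := mes_le _ missing_k; move/mult_eq0P: mes_missing.
by rewrite multE// xpair_eqE /= eqbF_neg -leqNgt => le_k_mes; lia.
Qed.

Lemma Omes_mes_fibre (A a k : nat) : 0 < a <= A ->
  Omes A a `&` mes A a @^-1` [set k * A + a] =
  with_mult (prescribed (progression A a k.+1) (fun t => (0, t < k * A + a))).
Proof.
move=> aA; apply/seteqP; split=> pi.
  move=> [pi_Omes /= mes_k]; apply/with_mult_progressionP => // t.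
  by rewrite -mes_k; apply: Omes_mult => //; lia.
move=> /(with_mult_progressionP _ _ _ aA) multE.
have mes_k := mes_eq_of_mult aA multE.
split=> // -[t b] t_pi /= t_a; rewrite mes_k => lt_tk.
have [/count_memPn no_plain _] := multE t (psize_gt0 t_pi) t_a (ltnW lt_tk).
by case: b t_pi => // t_pi; rewrite t_pi in no_plain.
Qed.

Local Open Scope ring_scope.

(** * Unordered sums *)

#[local] Existing Instance totally_filter.

Definition has_sum (K : numFieldType) (I : choiceType) (D : set I) (f : I -> K)
    (l : K) : Prop :=
  \sum_(i <- F | i \in D) f i @[F --> totally] --> l.

Lemma has_sum_set0 (K : numFieldType) (I : choiceType) (f : I -> K) : has_sum set0 f 0.
Proof.
by apply: cvg_near_cst; apply: nearW => F; rewrite big_pred0// => i; exact: in_set0.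
Qed.

Definition exhausts (I : choiceType) (S : nat -> seq I) (D : set I) : Prop :=
  [/\ forall N, uniq (S N), \forall N \near \oo, {subset S N <= D}
    & forall i, D i -> \forall N \near \oo, i \in S N].

Lemma exhausts_subset (I : choiceType) (S : nat -> seq I) (D : set I) (G : seq I) :
  exhausts S D -> {subset G <= D} -> \forall N \near \oo, {subset G <= S N}.
Proof.
move=> [_ _ S_covers]; elim: G => [|i G IHG] GD; first by near=> N.
have i_S : \forall N \near \oo, i \in S N.
  by apply/S_covers/set_mem/GD; rewrite mem_head.
have G_S : \forall N \near \oo, {subset G <= S N}.
  by apply: IHG => j j_G; rewrite GD// in_cons j_G orbT.
near=> N => j; rewrite in_cons => /predU1P[->|]; first by near: N.
by apply: (near G_S N).
Unshelve. all: by end_near. Qed.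

Lemma big_uniq_subset (T : Type) (idx : T) (op : Monoid.com_law idx) (I : eqType)
    (s1 s2 : seq I) (f : I -> T) : uniq s1 -> uniq s2 -> {subset s1 <= s2} ->
  \big[op/idx]_(i <- s2) f i =
  op (\big[op/idx]_(i <- s1) f i) (\big[op/idx]_(i <- s2 | i \notin s1) f i).
Proof.
move=> uniq_s1 uniq_s2 sub_s12; rewrite (bigID (mem s1)) /=; congr (op _ _).
rewrite -big_filter; apply/perm_big/uniq_perm; rewrite ?filter_uniq// => i.
by rewrite mem_filter andb_idr//; exact: sub_s12.
Qed.

(* In a mere numFieldType, where the order is partial, closed_ge is not available. *)
Lemma cvgn_ge0 (K : numFieldType) (u : nat -> K) (l : K) :
  (\forall n \near \oo, 0 <= u n) -> u @ \oo --> l -> 0 <= l.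
Proof.
move=> u_ge0 u_l; suff <- : `|l| = l by exact: normr_ge0.
apply: (cvg_unique (@norm_hausdorff _ _) _ u_l).
apply: cvg_trans (cvg_norm u_l); apply: near_eq_cvg.
by apply: filterS u_ge0 => n /ger0_norm.
Qed.

Lemma exhausts_sum_norm_le (K : numFieldType) (I : choiceType) (S : nat -> seq I)
    (D : set I) (f : I -> K) (L : K) (G : seq I) :
  exhausts S D -> \sum_(i <- S N) `|f i| @[N --> \oo] --> L ->
  uniq G -> {subset G <= D} -> \sum_(i <- G) `|f i| <= L.
Proof.
move=> S_D f_L uniq_G GD; have [uniq_S _ _] := S_D.
rewrite -subr_ge0; apply: (cvgn_ge0 _ (cvgB f_L (cvg_cst _))).
apply: filterS (exhausts_subset S_D GD) => N G_S.
by rewrite subr_ge0 (big_uniq_subset _ _ uniq_G (uniq_S N) G_S) lerDl sumr_ge0.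
Qed.

Lemma has_sum_exhaustion (K : numFieldType) (I : choiceType) (S : nat -> seq I)
    (D : set I) (f : I -> K) (l : K) :
  exhausts S D -> \sum_(i <- S N) f i @[N --> \oo] --> l ->
  cvgn (fun N => \sum_(i <- S N) `|f i|) -> has_sum D f l.
Proof.
move=> S_D f_l /cvg_ex[/= L f_L]; have [uniq_S SD _] := S_D.
apply/cvgrPdist_le => e e_gt0; have half_e_gt0 : 0 < e / 2 by rewrite divr_gt0.
have [N [SN_D near_l near_L]] : exists N, [/\ {subset S N <= D},
    `|l - \sum_(i <- S N) f i| <= e / 2 & `|L - \sum_(i <- S N) `|f i| | <= e / 2].
  move/cvgrPdist_le/(_ _ half_e_gt0) : f_l => f_l.
  move/cvgrPdist_le/(_ _ half_e_gt0) : f_L => f_L.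
  by apply: (@filter_ex _ \oo); near=> N; split; near: N.
exists [fset i in S N]%fset => //= F /fsubsetP S_F; rewrite -big_filter.
set G := [seq i <- F | i \in D].
have uniq_G : uniq G by rewrite filter_uniq.
have GD : {subset G <= D} by move=> i; rewrite mem_filter => /andP[].
have S_G : {subset S N <= G}.
  by move=> i i_S; rewrite mem_filter SN_D// S_F// inE.
have tail_le : \sum_(i <- G | i \notin S N) `|f i| <= L - \sum_(i <- S N) `|f i|.
  rewrite lerBrDl -(big_uniq_subset _ _ (uniq_S N) uniq_G S_G).
  exact: exhausts_sum_norm_le S_D f_L uniq_G GD.
rewrite (big_uniq_subset _ f (uniq_S N) uniq_G S_G) opprD addrA [leRHS]splitr.
apply: le_trans (ler_normB _ _) (lerD near_l _).
apply: le_trans (ler_norm_sum _ _ _) (le_trans tail_le _).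
by rewrite -[leLHS]ger0_norm// (le_trans _ tail_le)// sumr_ge0.
Unshelve. all: by end_near. Qed.

Lemma fps_has_sum_monom (K : numFieldType) (I : choiceType) (D : set I)
    (c : I -> K) (d : I -> nat) (g : fps K) :
  (forall n, has_sum (D `&` d @^-1` [set n]) c (g n)) ->
  fps_has_sum D (fun i => fps_monom (c i) (d i)) g.
Proof.
move=> sum_fibre n; apply: cvg_trans (sum_fibre n).
apply: near_eq_cvg; apply: nearW => F /=.
rewrite /fps_monom -big_mkcondr; apply: eq_bigl => i.
by rewrite in_setI; congr andb; apply/idP/eqP => [/set_mem//|->]; exact/mem_set.
Qed.

Lemma fps_series_monomE (K : numFieldType) (c : nat -> K) (d : nat -> nat) (k : nat) :
  injective d -> fps_series (fun k => fps_monom (c k) (d k)) (d k) = c k.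
Proof.
move=> d_inj; apply/cvg_lim; first exact: norm_hausdorff.
apply: cvg_near_cst; exists k.+1 => // N /= lt_kN; apply/eqP.
rewrite big_mkord (bigD1 (Ordinal lt_kN)) //= /fps_monom eqxx big1 ?addr0// => i.
by rewrite (inj_eq d_inj) -val_eqE/= eq_sym => /negbTE->.
Qed.

Lemma fps_series_monom_eq0 (K : numFieldType) (c : nat -> K) (d : nat -> nat) (n : nat) :
  (forall k, d k <> n) -> fps_series (fun k => fps_monom (c k) (d k)) n = 0.
Proof.
move=> d_neq_n; apply/cvg_lim; first exact: norm_hausdorff.
apply: cvg_near_cst; apply: nearW => N; rewrite big1// => k _.
by rewrite /fps_monom; case: eqP => // /esym/d_neq_n.
Qed.

(** * Generating functions of overpartitions with prescribed multiplicities *)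

Definition bounded_genfun (K : comNzRingType) (Q : nat -> pred (nat * bool)) (q : K)
    (N : nat) : K :=
  \sum_(pi <- bounded_overpartitions Q N) q ^+ weight pi.

Lemma has_sum_with_mult (K : numFieldType) (Q : nat -> pred (nat * bool)) (q l : K) :
  (\forall t \near \oo, Q t (0%N, false)) ->
  bounded_genfun Q q @ \oo --> l -> cvgn (bounded_genfun Q `|q|) ->
  has_sum (with_mult Q) (fun pi => q ^+ weight pi) l.
Proof.
move=> [T _ Q_large] q_l norm_q_cvg.
apply: (@has_sum_exhaustion _ _ (bounded_overpartitions Q)) => //.
- split=> [N | | pi pi_Q]; first exact: bounded_overpartitions_uniq.
  + exists T => // N /= le_TN pi /bounded_overpartitions_with_mult pi_Q.
    by apply/mem_set/pi_Q => t lt_Nt; apply: Q_large; exact: leq_trans (ltnW lt_Nt).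
  + by exists (weight pi) => // N le_N; exact: mem_bounded_overpartitions.
- rewrite (_ : (fun N => _) = bounded_genfun Q `|q|)//; apply/funext => N.
  by apply: eq_bigr => pi _; rewrite normrX.
Qed.

Lemma sum_free_mult (K : comNzRingType) (q : K) (t N : nat) :
  (1 - q ^+ t) * (\sum_(j : 'I_N.+1 * bool) q ^+ (t * (j.1 + j.2))) =
  (1 + q ^+ t) * (1 - q ^+ (t * N.+1)).
Proof.
rewrite -(pair_big xpredT xpredT (fun (i : 'I_N.+1) (b : bool) => q ^+ (t * (i + b)))) /=.
have sum_overlined (i : 'I_N.+1) :
    \sum_(b : bool) q ^+ (t * (i + b)) = (1 + q ^+ t) * q ^+ t ^+ i.
  by rewrite big_bool /= addn0 mulnDr muln1 exprD !exprM; ring.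
rewrite (eq_bigr _ (fun i _ => sum_overlined i)) -mulr_sumr mulrCA; congr (_ * _).
by rewrite exprM -[RHS]opprB subrX1 -mulNr opprB.
Qed.

Lemma sum_prescribed_mult (K : comNzRingType) (q : K) (S : seq nat)
    (m : nat -> nat * bool) (t N : nat) : t \in S -> ((m t).1 <= N)%N ->
  \sum_(j : 'I_N.+1 * bool | prescribed S m t (val j.1, j.2)) q ^+ (t * (j.1 + j.2)) =
  q ^+ (t * ((m t).1 + (m t).2)).
Proof.
move=> t_S; rewrite /prescribed t_S; case: (m t) => k c /= le_kN.
rewrite (big_pred1 (inord k, c)) /= ?inordK// => -[i b].
by rewrite /= !xpair_eqE -[i == _]val_eqE /= inordK.
Qed.

Lemma big_ord_succ_mem (T : Type) (idx : T) (op : Monoid.com_law idx) (S : seq nat)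
    (N : nat) (G : nat -> T) : uniq S -> {in S, forall t, (0 < t <= N)%N} ->
  \big[op/idx]_(i < N | i.+1 \in S) G i.+1 = \big[op/idx]_(t <- S) G t.
Proof.
move=> uniq_S S_N; rewrite -(big_mkord (fun i => i.+1 \in S) (fun i => G i.+1)).
rewrite -(big_add1 _ _ 0 N.+1 (fun t => t \in S) G) -big_filter.
apply/perm_big/uniq_perm; rewrite ?filter_uniq ?iota_uniq// => t.
rewrite mem_filter mem_index_iota ltnS.
by case: (boolP (t \in S)) => // /S_N.
Qed.

(* The quotient of the contributions of the size t to the generating function with
   and without its multiplicity prescribed:
   q^(t (m.1 + m.2)) / ((1 + q^t) / (1 - q^t)). *)
Definition prescribed_factor (K : fieldType) (q : K) (m : nat -> nat * bool)
    (t : nat) : K :=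
  q ^+ (t * ((m t).1 + (m t).2)) * ((1 - q ^+ t) / (1 + q ^+ t)).

Lemma bounded_genfun_prescribed (K : fieldType) (q : K) (S : seq nat)
    (m : nat -> nat * bool) (N : nat) :
  (forall t, (0 < t)%N -> 1 - q ^+ t != 0) ->
  (forall t, (0 < t)%N -> 1 + q ^+ t != 0) ->
  uniq S -> {in S, forall t, (0 < t <= N)%N && ((m t).1 <= N)%N} ->
  bounded_genfun (prescribed S m) q N =
  \prod_(i < N) (1 + q ^+ i.+1) / \prod_(i < N) (1 - q ^+ i.+1)
  * \prod_(i < N | i.+1 \notin S) (1 - q ^+ (i.+1 * N.+1))
  * \prod_(t <- S) prescribed_factor q m t.
Proof.
move=> subq_neq0 addq_neq0 uniq_S S_N.
have S_range : {in S, forall t, (0 < t <= N)%N} by move=> t /S_N /andP[].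
rewrite /bounded_genfun sum_bounded_overpartitions -prodf_div.
rewrite -(big_ord_succ_mem _ _ uniq_S S_range) (bigID (fun i : 'I_N => i.+1 \in S)) /=.
rewrite [in RHS](bigID (fun i : 'I_N => i.+1 \in S)) /= -[RHS]mulrA [X in _ = _ * X]mulrC.
rewrite mulrACA -!big_split /=; congr (_ * _); apply: eq_bigr => i i_S.
  have /andP[_ le_mN] := S_N _ i_S.
  rewrite sum_prescribed_mult// /prescribed_factor; field.
  by rewrite subq_neq0 ?addq_neq0.
apply: (mulfI (subq_neq0 i.+1 isT)).
rewrite (eq_bigl xpredT) ?sum_free_mult; last first.
  by move=> j; rewrite /bounded_mult /prescribed /= (negbTE i_S).
by field; rewrite subq_neq0.
Qed.

Lemma prod_exp_progression (K : comNzRingType) (q : K) (A a k : nat) :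
  \prod_(j < k) q ^+ (j * A + a) = q ^+ (A * 'C(k, 2) + k * a).
Proof.
rewrite prodrXr; congr (_ ^+ _); elim: k => [|k IHk]; first by rewrite big_ord0 muln0.
by rewrite big_ord_recr /= IHk binS bin1; nia.
Qed.

Definition mes_coef (K : fieldType) (q : K) (A a k : nat) : K :=
  q ^+ (A * 'C(k, 2) + k * a) *
  \prod_(j < k.+1) ((1 - q ^+ (j * A + a)) / (1 + q ^+ (j * A + a))).

Lemma prod_mes_progression (K : fieldType) (q : K) (A a k : nat) : (0 < A)%N ->
  \prod_(t <- progression A a k.+1)
     prescribed_factor q (fun t => (0%N, (t < k * A + a)%N)) t =
  mes_coef q A a k.
Proof.
move=> A_gt0; rewrite big_map -/(index_iota 0 k.+1) big_mkord big_split /=; congr (_ * _).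
rewrite big_ord_recr /= ltnn muln0 mulr1 -prod_exp_progression.
by apply: eq_bigr => j _; rewrite ltn_add2r ltn_pmul2r// ltn_ord muln1.
Qed.

(** * Absolutely convergent products of complex numbers *)

Lemma oneB_neq0 (K : numDomainType) (x : K) : `|x| < 1 -> 1 - x != 0.
Proof.
move=> x_lt1; rewrite subr_eq0; apply: contraTneq x_lt1 => <-.
by rewrite normr1 ltxx.
Qed.

Lemma oneD_neq0 (K : numDomainType) (x : K) : `|x| < 1 -> 1 + x != 0.
Proof. by move=> x_lt1; rewrite -[x]opprK oneB_neq0 ?normrN. Qed.

Lemma normrX_lt1 (K : numDomainType) (x : K) (n : nat) :
  `|x| < 1 -> (0 < n)%N -> `|x ^+ n| < 1.
Proof. by move=> x_lt1 n_gt0; rewrite normrX exprn_ilt1// -lt0n. Qed.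

Local Open Scope complex_scope.
Import Normc.

Section Normc.
Variable R : rcfType.
Implicit Types z : R[i].

Lemma normr_normc z : `|z| = (normc z)%:C.
Proof. by case: z. Qed.

Lemma normc_ge0 z : 0 <= normc z.
Proof. by rewrite -ler0c -normr_normc. Qed.

Lemma normcX z (n : nat) : normc (z ^+ n) = normc z ^+ n.
Proof. by elim: n => [|n IHn]; rewrite ?normc1// !exprS normcM IHn. Qed.

Lemma Re_le_normc z : `|complex.Re z| <= normc z.
Proof. by rewrite -lecR -normr_normc normc_ge_Re. Qed.

Lemma Im_le_normc z : `|complex.Im z| <= normc z.
Proof. by case: z => x y /=; rewrite -sqrtr_sqr ler_wsqrtr// lerDr sqr_ge0. Qed.

Lemma normc_le_ReIm z : normc z <= `|complex.Re z| + `|complex.Im z|.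
Proof.
case: z => x y /=; rewrite -[leRHS]ger0_norm ?addr_ge0// -[leRHS]sqrtr_sqr ler_wsqrtr//.
by rewrite sqrrD !real_normK ?num_real// addrAC lerDl mulrn_wge0// mulr_ge0.
Qed.

End Normc.

Section Complex.
Variable R : realType.

(* R[i] is a topological space as a numFieldType, and inference finds this
   structure only when the type is written in this form. *)
Local Notation C := (Num.NumField.sort (R[i] : numFieldType)).
Implicit Types (u : nat -> C) (q x : C).

Lemma cvg_normc u (l : C) : normc (u n - l) @[n --> \oo] --> (0 : R) -> u @ \oo --> l.
Proof.
move=> /cvgr0Pnorm_le norm_cvg; apply/cvgrPdistC_le => -[e e'].
rewrite ltcE /= => /andP[/eqP-> /norm_cvg]; apply: filterS => n.
by rewrite ger0_norm ?normc_ge0// normr_normc lecR.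
Qed.

Lemma cvg_ReIm u (a b : R) : complex.Re (u n) @[n --> \oo] --> a ->
  complex.Im (u n) @[n --> \oo] --> b -> u @ \oo --> (a +i* b : C).
Proof.
move=> Re_a Im_b; apply: cvg_normc.
apply: (@squeeze_cvgr _ _ _ _ (cst 0)
  (fun n => `|complex.Re (u n) - a| + `|complex.Im (u n) - b|)).
- apply: nearW => n; rewrite normc_ge0 (le_trans (normc_le_ReIm _))//.
  by case: (u n).
- exact: cvg_cst.
- rewrite -[X in _ --> X](addr0 (0 : R)).
  by apply: cvgD; apply/norm_cvg0P/subr_cvg0.
Qed.

Definition absolutely_summable u : Prop := cvgn (series (fun k => normc (u k))).

Lemma absolutely_summable_cvg u : absolutely_summable u -> cvgn (series u).
Proof.
move=> norm_cvg.
have part_cvg (p : {additive R[i] -> R}) : (forall z, `|p z| <= normc z) ->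
    exists l : R, p (series u n) @[n --> \oo] --> l.
  move=> p_le; apply/cvg_ex.
  rewrite (_ : (fun n => _) = series (fun k => p (u k))); last first.
    by apply/funext => n; exact: raddf_sum.
  by apply/normed_cvg/(series_le_cvg _ _ _ norm_cvg) => k //=; exact: normc_ge0.
have [a Re_a] := part_cvg (@complex.Re R) (@Re_le_normc R).
have [b Im_b] := part_cvg (@complex.Im R) (@Im_le_normc R).
by apply/cvg_ex; exists (a +i* b); apply: cvg_ReIm.
Qed.

Lemma normc_prod1D_le (I : Type) (s : seq I) (P : pred I) (u : I -> R[i]) :
  normc (\prod_(i <- s | P i) (1 + u i)) <= expR (\sum_(i <- s | P i) normc (u i)).
Proof.
elim/big_rec2: _ => [|i y z _ normc_z_le]; first by rewrite normc1 expR0.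
rewrite normcM expRD ler_pM ?normc_ge0// (le_trans _ (expR_ge1Dx _))//.
by rewrite (le_trans (le_normcD _ _))// normc1.
Qed.

Lemma normc_prod1D_sub1_le (I : Type) (s : seq I) (P : pred I) (u : I -> R[i]) :
  normc (\prod_(i <- s | P i) (1 + u i) - 1) <=
  expR (\sum_(i <- s | P i) normc (u i)) - 1.
Proof.
elim/big_rec2: _ => [|i y z _ normc_z_le]; first by rewrite subrr normc0 expR0 subrr.
have -> : (1 + u i) * z - 1 = (1 + u i) * (z - 1) + u i by ring.
apply: le_trans (le_normcD _ _) _; rewrite normcM expRD.
have normc_1D_le : normc (1 + u i) <= 1 + normc (u i).
  by rewrite (le_trans (le_normcD _ _))// normc1.
have := expR_ge1Dx (normc (u i)); have := expR_gt0 y.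
by have := normc_ge0 (u i); have := normc_ge0 (z - 1); nra.
Qed.

Lemma is_cvg_prod1D u : absolutely_summable u ->
  cvgn (fun n => \prod_(0 <= k < n) (1 + u k)).
Proof.
move=> norm_cvg; pose P n := \prod_(0 <= k < n) (1 + u k).
pose B := expR (limn (series (fun k => normc (u k)))).
have P_telescope : P = cst 1 + series (fun k => P k * u k).
  apply/funext => n; rewrite /= -[LHS](subrK (P 0%N)) -telescope_sumr// addrC.
  congr (_ + _); first by rewrite /P big_geq.
  by apply: eq_bigr => k _; rewrite /P big_nat_recr//= mulrDr mulr1 addrC addKr.
rewrite -[X in cvgn X]/P P_telescope.
apply: is_cvgD; [exact: is_cvg_cst | apply: absolutely_summable_cvg].
apply: (@series_le_cvg _ _ (B *: (fun k => normc (u k)))) => [k|k|k|].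
- exact: normc_ge0.
- by rewrite mulr_ge0 ?expR_ge0 ?normc_ge0.
- rewrite normcM ler_wpM2r ?normc_ge0// (le_trans (normc_prod1D_le _ _ _))// ler_expR.
  apply: (nondecreasing_cvgn_le _ norm_cvg); apply: nondecreasing_series => i _ _.
  exact: normc_ge0.
- exact: is_cvg_seriesZ.
Qed.

Lemma normc_inv1D_bounded u : normc (u k) @[k --> \oo] --> (0 : R) ->
  (forall k, 1 + u k != 0) -> exists M, forall k, normc (1 + u k)^-1 <= M.
Proof.
move=> norm_u_0 u_neq0.
have norm_1Du : normc (1 + u k) @[k --> \oo] --> (1 : R).
  apply: (@squeeze_cvgr _ _ _ _ (fun k => 1 - normc (u k)) (fun k => 1 + normc (u k))).
  - apply: nearW => k; have := le_normcD (1 + u k) (- u k).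
    have := le_normcD 1 (u k); rewrite addrK normc1 normcN => -> le_1.
    by rewrite lerBlDr le_1.
  - by have := cvgB (cvg_cst (1 : R)) norm_u_0; rewrite subr0; apply.
  - by have := cvgD (cvg_cst (1 : R)) norm_u_0; rewrite addr0; apply.
have norm_inv_cvg : cvgn (fun k => (normc (1 + u k))^-1).
  by apply: is_cvgV; rewrite ?(cvg_lim _ norm_1Du) ?oner_neq0//; exact: cvgP norm_1Du.
have [M M_ub] := bounded_fun_has_ubound (cvg_seq_bounded norm_inv_cvg).
by exists M => k; rewrite normcV; apply: M_ub; exists k.
Qed.

(* The product of the inverses 1 / (1 + u k) = 1 - u k / (1 + u k) converges as well. *)
Lemma lim_prod1D_neq0 u : absolutely_summable u ->
  (forall k, 1 + u k != 0) -> limn (fun n => \prod_(0 <= k < n) (1 + u k)) != 0.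
Proof.
move=> norm_cvg u_neq0; pose v k := - u k / (1 + u k).
have inverse n : \prod_(0 <= k < n) (1 + u k) * \prod_(0 <= k < n) (1 + v k) = 1.
  rewrite -big_split big1//= => k _; rewrite /v; field; exact: u_neq0.
have v_cvg : absolutely_summable v.
  have [M M_ub] := normc_inv1D_bounded (cvg_series_cvg_0 norm_cvg) u_neq0.
  apply: (@series_le_cvg _ _ (M *: (fun k => normc (u k)))) => [k|k|k|].
  - exact: normc_ge0.
  - by rewrite mulr_ge0 ?normc_ge0// (le_trans _ (M_ub 0%N))// normc_ge0.
  - by rewrite normcM normcN mulrC ler_wpM2r ?normc_ge0.
  - exact: is_cvg_seriesZ.
have lim_inverse : limn (fun n => \prod_(0 <= k < n) (1 + u k)) *
    limn (fun n => \prod_(0 <= k < n) (1 + v k)) = 1.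
  rewrite -limM; [|exact: is_cvg_prod1D..].
  by rewrite (_ : _ \* _ = cst 1) ?lim_cst//; exact/funext.
by apply: contra_eq_neq lim_inverse => ->; rewrite mul0r eq_sym oner_neq0.
Qed.

(** * The q-Pochhammer symbol *)

Lemma geometric_absolutely_summable q x : `|q| < 1 ->
  absolutely_summable (fun i => - (x * q ^+ i)).
Proof.
move=> q_lt1; rewrite /absolutely_summable (_ : (fun i => _) = geometric (normc x) (normc q)).
  by apply: is_cvg_geometric_series; rewrite ger0_norm ?normc_ge0// -ltcR -normr_normc.
by apply/funext => i; rewrite normcN normcM normcX.
Qed.

Lemma cvg_qpoch_inf q x : `|q| < 1 ->
  \prod_(0 <= i < n) (1 - x * q ^+ i) @[n --> \oo] --> qpoch_inf x q.
Proof.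
by move=> q_lt1; apply/(is_cvg_prod1D (u := fun i => _))/geometric_absolutely_summable.
Qed.

Lemma qpoch_inf_neq0 q x : `|q| < 1 -> (forall i, 1 - x * q ^+ i != 0) ->
  qpoch_inf x q != 0.
Proof.
move=> q_lt1; apply: (lim_prod1D_neq0 (u := fun i => - (x * q ^+ i))).
exact: geometric_absolutely_summable.
Qed.

Lemma qpoch_inf_split q x (m : nat) : `|q| < 1 ->
  qpoch_inf x q = \prod_(0 <= i < m) (1 - x * q ^+ i) * qpoch_inf (x * q ^+ m) q.
Proof.
move=> q_lt1; pose head := \prod_(0 <= i < m) (1 - x * q ^+ i).
have split_prod n : \prod_(0 <= i < n + m) (1 - x * q ^+ i) =
    head * \prod_(0 <= i < n) (1 - x * q ^+ m * q ^+ i).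
  rewrite (big_cat_nat _ (leq_addl n m))//=; congr (_ * _).
  rewrite -{1}[m]add0n big_addn addnK; apply: eq_bigr => i _.
  by rewrite -mulrA -exprD addnC.
apply/cvg_lim; first exact: norm_hausdorff.
rewrite -(cvg_shiftn m (fun n => \prod_(0 <= i < n) (1 - x * q ^+ i) : C)).
rewrite (_ : [sequence _]_n =
    cst head \* (fun n => \prod_(0 <= i < n) (1 - x * q ^+ m * q ^+ i)));
  last exact/funext.
by apply: cvgM; [exact: cvg_cst | exact: cvg_qpoch_inf].
Qed.

Lemma qpochE q x (n : nat) : `|q| < 1 -> (forall i, 1 - x * q ^+ i != 0) ->
  qpoch x q n = \prod_(0 <= i < n) (1 - x * q ^+ i).
Proof.
move=> q_lt1 x_neq; rewrite /qpoch (qpoch_inf_split x n q_lt1) mulfK//.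
by apply: qpoch_inf_neq0 => // i; rewrite -mulrA -exprD.
Qed.

Lemma qpoch_progression q x (A a n : nat) : `|q| < 1 -> (0 < A)%N ->
  (forall j, 1 - x * q ^+ (j * A + a) != 0) ->
  qpoch (x * q ^+ a) (q ^+ A) n = \prod_(j < n) (1 - x * q ^+ (j * A + a)).
Proof.
move=> q_lt1 A_gt0 factor_neq0.
have factorE j : x * q ^+ a * q ^+ A ^+ j = x * q ^+ (j * A + a).
  by rewrite -mulrA -exprM -exprD addnC mulnC.
rewrite qpochE ?normrX_lt1// => [|j]; last by rewrite factorE.
by rewrite big_mkord; apply: eq_bigr => j _; rewrite factorE.
Qed.

(** * The generating function of Omes *)

(* These factors come from truncating at the multiplicity N the geometric series that
   counts the plain parts of size i.+1. *)
Lemma cvg_prod_truncation q (P : pred nat) : `|q| < 1 ->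
  \prod_(i < N | P i) (1 - q ^+ (i.+1 * N.+1)) @[N --> \oo] --> (1 : C).
Proof.
move=> q_lt1; pose r := normc q.
have r_ge0 : 0 <= r := normc_ge0 q.
have r_lt1 : r < 1 by rewrite -ltcR -normr_normc.
have norm_r_lt1 : `|r| < 1 by rewrite ger0_norm.
apply: cvg_normc.
apply: (@squeeze_cvgr _ _ _ _ (cst 0)
  (fun N => expR (r ^+ N * series (geometric 1 r) N) - 1)).
- apply: nearW => N; rewrite normc_ge0 /= (le_trans (normc_prod1D_sub1_le _ _ _))//.
  rewrite lerB// ler_expR /series /= mulr_sumr big_mkord big_mkcond /=.
  apply: ler_sum => i _; case: ifP => _; last by rewrite !mulr_ge0 ?exprn_ge0.
  by rewrite normcN normcX mul1r -exprD ler_wiXn2l ?(ltW r_lt1)//; nia.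
- exact: cvg_cst.
- have exponent_0 : r ^+ N * series (geometric 1 r) N @[N --> \oo] --> (0 : R).
    have := cvgM (cvg_expr norm_r_lt1) (@cvg_geometric_series R 1 r norm_r_lt1).
    by rewrite mul0r; apply.
  have expR_1 : expR (r ^+ N * series (geometric 1 r) N) @[N --> \oo] --> expR (0 : R).
    by apply: continuous_cvg exponent_0; exact: continuous_expR.
  by rewrite expR0 in expR_1; have := cvgB expR_1 (cvg_cst (1 : R)); rewrite subrr; apply.
Qed.

Lemma cvg_bounded_genfun_prescribed q (S : seq nat) (m : nat -> nat * bool) :
  `|q| < 1 -> uniq S -> {in S, forall t, (0 < t)%N} ->
  bounded_genfun (prescribed S m) q @ \oo -->
  qpoch_inf (- q) q / qpoch_inf q q * \prod_(t <- S) prescribed_factor q m t.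
Proof.
move=> q_lt1 uniq_S S_gt0.
have cvg_prod x : \prod_(i < N) (1 - x * q ^+ i) @[N --> \oo] --> qpoch_inf x q.
  under eq_cvg do rewrite -(big_mkord xpredT (fun i => 1 - x * q ^+ i)).
  exact: cvg_qpoch_inf.
have qq_neq0 : qpoch_inf q q != 0.
  by apply: qpoch_inf_neq0 => // i; rewrite -exprS oneB_neq0 ?normrX_lt1.
set prescribed_part := (X in _ * X).
have : \prod_(i < N) (1 - - q * q ^+ i) / \prod_(i < N) (1 - q * q ^+ i)
    * \prod_(i < N | i.+1 \notin S) (1 - q ^+ (i.+1 * N.+1)) * prescribed_part
      @[N --> \oo] -->
    qpoch_inf (- q) q / qpoch_inf q q * 1 * prescribed_part.
  apply: cvgM; last exact: cvg_cst.
  apply: cvgM; last exact: (@cvg_prod_truncation q (fun i => i.+1 \notin S)).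
  by apply: cvgM => //; exact: cvgV.
rewrite mulr1; apply: cvg_trans; apply: near_eq_cvg.
exists (\max_(t <- S) maxn t (m t).1)%N => // N /= le_maxN.
rewrite bounded_genfun_prescribed//.
- congr (_ / _ * _ * _); apply: eq_bigr => i _; last by rewrite exprS.
  by rewrite mulNr opprK exprS.
- by move=> t t_gt0; rewrite oneB_neq0 ?normrX_lt1.
- by move=> t t_gt0; rewrite oneD_neq0 ?normrX_lt1.
- move=> t t_S; rewrite S_gt0//= -geq_max; apply: leq_trans le_maxN.
  exact: (@leq_bigmax_seq _ S xpredT (fun t => maxn t (m t).1)).
Qed.

Lemma has_sum_prescribed q (S : seq nat) (m : nat -> nat * bool) :
  `|q| < 1 -> uniq S -> {in S, forall t, (0 < t)%N} ->
  has_sum (with_mult (prescribed S m)) (fun pi => q ^+ weight pi)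
    (qpoch_inf (- q) q / qpoch_inf q q * \prod_(t <- S) prescribed_factor q m t).
Proof.
move=> q_lt1 uniq_S S_gt0; apply: has_sum_with_mult.
- exists (\max_(t <- S) t).+1 => // t /= lt_max_t; apply/implyP => t_S.
  by have := @leq_bigmax_seq _ S xpredT id t t_S isT; rewrite leqNgt lt_max_t.
- exact: cvg_bounded_genfun_prescribed.
- by apply/cvg_ex; eexists; apply: cvg_bounded_genfun_prescribed; rewrite ?normr_id.
Qed.

(* With w := q^(kA+a), the bracket collapses because (1 + w) - 2 w = 1 - w. *)
Lemma mes_coefE q (A a k : nat) : `|q| < 1 -> (0 < a <= A)%N ->
  q ^+ (A * 'C(k, 2) + k * a)
    * (qpoch (q ^+ a) (q ^+ A) k / qpoch (- q ^+ a) (q ^+ A) k)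
  - 2 * q ^+ (A * 'C(k.+1, 2) + k.+1 * a)
    * (qpoch (q ^+ a) (q ^+ A) k / qpoch (- q ^+ a) (q ^+ A) k.+1) =
  mes_coef q A a k.
Proof.
move=> q_lt1 /andP[a_gt0 le_aA]; have A_gt0 := leq_trans a_gt0 le_aA.
have exp_lt1 j : `|q ^+ (j * A + a)| < 1 by rewrite normrX_lt1// addn_gt0 a_gt0 orbT.
have qpoch_pos n : qpoch (q ^+ a) (q ^+ A) n = \prod_(j < n) (1 - q ^+ (j * A + a)).
  rewrite -[q ^+ a]mul1r qpoch_progression// => [|j]; last by rewrite mul1r oneB_neq0.
  by apply: eq_bigr => j _; rewrite mul1r.
have qpoch_neg n : qpoch (- q ^+ a) (q ^+ A) n = \prod_(j < n) (1 + q ^+ (j * A + a)).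
  rewrite -mulN1r qpoch_progression// => [|j]; last by rewrite mulN1r opprK oneD_neq0.
  by apply: eq_bigr => j _; rewrite mulN1r opprK.
rewrite /mes_coef !qpoch_pos !qpoch_neg -!prod_exp_progression !big_ord_recr /= prodf_div.
have neg_neq0 : \prod_(j < k) (1 + q ^+ (j * A + a)) != 0.
  by apply/prodf_neq0 => j _; exact: oneD_neq0.
by field; rewrite neg_neq0 oneD_neq0.
Qed.

Lemma has_sum_Omes_mes q (A a k : nat) : `|q| < 1 -> (0 < a <= A)%N ->
  has_sum (Omes A a `&` mes A a @^-1` [set (k * A + a)%N]) (fun pi => q ^+ weight pi)
    (qpoch_inf (- q) q / qpoch_inf q q * mes_coef q A a k).
Proof.
move=> q_lt1 aA; have [a_gt0 A_gt0] : (0 < a)%N /\ (0 < A)%N by lia.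
rewrite Omes_mes_fibre// -prod_mes_progression//; apply: has_sum_prescribed => //.
  exact: progression_uniq.
by move=> t; exact: progression_gt0.
Qed.

End Complex.

Unset Implicit Arguments.

Theorem theorem2p4 (R : realType) (A a : nat) (q : R[i]) :
  (1 <= a <= A)%N -> `|q| < 1 ->
  fps_has_sum (Omes A a)
    (fun pi => fps_monom (q ^+ weight pi) (mes A a pi))
    (fps_scale (qpoch_inf (- q) q / qpoch_inf q q)
      (fps_series (fun k : nat =>
        fps_monom
          (q ^+ (A * 'C(k, 2) + k * a)
             * (qpoch (q ^+ a) (q ^+ A) k / qpoch (- q ^+ a) (q ^+ A) k)
           - 2 * q ^+ (A * 'C(k.+1, 2) + k.+1 * a)
             * (qpoch (q ^+ a) (q ^+ A) k / qpoch (- q ^+ a) (q ^+ A) k.+1))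
          (k * A + a)))).
Proof.
move=> aA q_lt1; apply: fps_has_sum_monom => n.
have [[k ->]|n_out] := pselect (exists k, n = k * A + a)%N.
  have progression_inj : injective (fun k => k * A + a)%N by move=> i j; nia.
  rewrite /fps_scale (fps_series_monomE _ _ progression_inj) mes_coefE//.
  exact: has_sum_Omes_mes.
rewrite (_ : _ `&` _ = set0).
  rewrite /fps_scale fps_series_monom_eq0 ?mulr0; first exact: has_sum_set0.
  by move=> k k_n; apply: n_out; exists k.
rewrite -subset0 => pi [_ /= mes_n]; apply: n_out.
by have [k mes_k] := mes_progression pi aA; exists k; rewrite -mes_n.
Qed.
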